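(* Let $W\in\mathbb{R}^{M\times R}$ and let $\mu\in\left[0,\frac{2}{\|W^\top W\|_{\mathrm F}}\right]$ if $W\neq O$, and $\mu\in[0,\infty)$ if $W=O$. Let $T_{W,\mu}:\mathbb{R}^{R\times N}\to\mathbb{R}^{R\times N}$ be defined for all $H\in\mathbb{R}^{R\times N}$ by $$T_{W,\mu}(H):=P_{\mathbb{R}_+^{R\times N}}\left[H-\mu\nabla_Hf(W,H)\right]=P_{\mathbb{R}_+^{R\times N}}\left[H-\mu W^\top(WH-V)\right].$$ Then $T_{W,\mu}$ is nonexpansive, i.e., $\|T_{W,\mu}(H_1)-T_{W,\mu}(H_2)\|_{\mathrm F}\le\|H_1-H_2\|_{\mathrm F}$ for all $H_1,H_2\in\mathbb{R}^{R\times N}$; and, if $\mu>0$, then $$\mathrm{Fix}(T_{W,\mu})=\operatorname*{argmin}_{H\in\mathbb{R}_+^{R\times N}}f(W,H).$$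
   Context: $M,N,R$ are positive integers with $R<\min\{M,N\}$, and $V\in\mathbb{R}_+^{M\times N}$ is a given matrix, where $\mathbb{R}_+^{m\times n}$ denotes the set of entrywise nonnegative real $m\times n$ matrices. $O$ is the zero matrix and $\|\cdot\|_{\mathrm F}$ is the Frobenius norm. $f(W,H):=\frac12\|V-WH\|_{\mathrm F}^2$ for $(W,H)\in\mathbb{R}^{M\times R}\times\mathbb{R}^{R\times N}$, and $\nabla_Hf(W,H)=W^\top(WH-V)$ is the gradient of $f(W,\cdot)$ at $H$. $P_K$ denotes the metric projection (w.r.t. $\|\cdot\|_{\mathrm F}$) onto a nonempty closed convex set $K$. $\mathrm{Fix}(T):=\{H:T(H)=H\}$. $\operatorname{argmin}_{H\in K}g(H)$ is the set of all minimizers of $g$ over $K$. *)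

(* Defs.v *)
From mathcomp Require Import all_boot all_order all_algebra.
From mathcomp Require Import all_classical all_reals all_analysis.
Set Implicit Arguments.
Unset Strict Implicit.
Unset Printing Implicit Defensive.
Import Order.TTheory GRing.Theory Num.Theory.
Import numFieldNormedType.Exports.
Local Open Scope classical_set_scope.
Local Open Scope ring_scope.

(* The library's norm `|A| on matrices is the max norm, hence this one. *)
Definition frob (K : realType) (m n : nat) (A : 'M[K]_(m, n)) : K :=
  Num.sqrt (\sum_i \sum_j A i j ^+ 2).

Definition nonneg_mx (K : realType) (m n : nat) : set 'M[K]_(m, n) :=
  [set A | forall i j, 0 <= A i j].
Arguments nonneg_mx : clear implicits.

Definition argmin (K : realType) (T : Type) (C : set T) (g : T -> K) : set T :=
  [set x | C x /\ forall y, C y -> g x <= g y].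

(* The nearest point is unique when C is nonempty, closed and convex; the
   default value 0 is used only if C has no nearest point to A. *)
Definition metric_proj (K : realType) (m n : nat) (C : set 'M[K]_(m, n))
    (A : 'M[K]_(m, n)) : 'M[K]_(m, n) :=
  xget 0 (argmin C (fun B => frob (A - B))).

Definition Fix (T : Type) (F : T -> T) : set T := [set x | F x = x].

Definition nonexpansive (K : realType) (m n p q : nat)
    (F : 'M[K]_(m, n) -> 'M[K]_(p, q)) : Prop :=
  forall A B, frob (F A - F B) <= frob (A - B).

(* Matrix of partial derivatives, i.e. the gradient with respect to the
   Frobenius inner product. *)
Definition gradient (K : realType) (m n : nat) (g : 'M[K]_(m, n) -> K)
    (A : 'M[K]_(m, n)) : 'M[K]_(m, n) :=
  \matrix_(i, j) 'D_(delta_mx i j) g A.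

Definition nmf_obj (K : realType) (M N R : nat) (V : 'M[K]_(M, N))
    (W : 'M[K]_(M, R)) (H : 'M[K]_(R, N)) : K :=
  2^-1 * frob (V - W *m H) ^+ 2.

Definition nmf_T (K : realType) (M N R : nat) (V : 'M[K]_(M, N))
    (W : 'M[K]_(M, R)) (mu : K) (H : 'M[K]_(R, N)) : 'M[K]_(R, N) :=
  metric_proj (nonneg_mx K R N) (H - mu *: gradient (nmf_obj V W) H).

(* Main.v *)
(* The projection onto the nonnegative matrices is the entrywise positive part,
   which is 1-Lipschitz entry by entry.  The gradient step acts on differences
   as D |-> D - mu W^T W D, and |W^T E|^2 <= |W W^T| |E|^2 = |W^T W| |E|^2 with
   E = W D makes it nonexpansive when mu |W^T W| <= 2.  For the fixed points, f
   is quadratic: f(H + D) = f(H) + <G, D> + |W D|^2 / 2 with G the gradient.  A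
   fixed point has G >= 0 and G complementary to H, so <G, H' - H> >= 0 for
   every H' >= 0.  Conversely, with D = T(H) - H one has
   mu <G, D> + |D|^2 <= 0, while <G, D> >= 0 at a minimizer by convexity. *)
Require Import Defs.
From mathcomp Require Import all_boot all_order all_algebra.
From mathcomp Require Import all_classical all_reals all_analysis.
From mathcomp Require Import ring lra.
Import Order.TTheory GRing.Theory Num.Theory.
Import numFieldNormedType.Exports.
Local Open Scope classical_set_scope.
Local Open Scope ring_scope.

(** The trace form lets bilinearity and adjunction follow from matrix algebra; [frob_ipE] recovers
    the entrywise sum. *)
Definition frob_ip {K : realType} {m n : nat} (A B : 'M[K]_(m, n)) : K :=
  \tr (A^T *m B).

Section FrobeniusGeometry.
Set Implicit Arguments.
Unset Strict Implicit.
Variable K : realType.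
Implicit Types (m n p : nat).

(** * Frobenius inner product and norm *)

Lemma frob_ipE m n (A B : 'M[K]_(m, n)) :
  frob_ip A B = \sum_i \sum_j A i j * B i j.
Proof.
rewrite exchange_big /=; apply: eq_bigr => j _; rewrite !mxE.
by apply: eq_bigr => i _; rewrite mxE.
Qed.

Lemma frob_ipC m n (A B : 'M[K]_(m, n)) : frob_ip A B = frob_ip B A.
Proof. by rewrite /frob_ip -mxtrace_tr trmx_mul trmxK. Qed.

Lemma frob_ipDr m n (A B C : 'M[K]_(m, n)) :
  frob_ip A (B + C) = frob_ip A B + frob_ip A C.
Proof. by rewrite /frob_ip mulmxDr mxtraceD. Qed.

Lemma frob_ipZr m n (a : K) (A B : 'M[K]_(m, n)) :
  frob_ip A (a *: B) = a * frob_ip A B.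
Proof. by rewrite /frob_ip -scalemxAr mxtraceZ. Qed.

Lemma frob_ipDl m n (A B C : 'M[K]_(m, n)) :
  frob_ip (A + B) C = frob_ip A C + frob_ip B C.
Proof. by rewrite frob_ipC frob_ipDr !(frob_ipC C). Qed.

Lemma frob_ipZl m n (a : K) (A B : 'M[K]_(m, n)) :
  frob_ip (a *: A) B = a * frob_ip A B.
Proof. by rewrite frob_ipC frob_ipZr frob_ipC. Qed.

Lemma frob_ipNr m n (A B : 'M[K]_(m, n)) : frob_ip A (- B) = - frob_ip A B.
Proof. by rewrite -scaleN1r frob_ipZr mulN1r. Qed.

Lemma frob_ipNl m n (A B : 'M[K]_(m, n)) : frob_ip (- A) B = - frob_ip A B.
Proof. by rewrite frob_ipC frob_ipNr frob_ipC. Qed.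

Lemma frob_ip0r m n (A : 'M[K]_(m, n)) : frob_ip A 0 = 0.
Proof. by rewrite -(scale0r 0) frob_ipZr mul0r. Qed.

Lemma frob_ip_mull m n p (W : 'M[K]_(m, n)) (A : 'M[K]_(n, p))
    (B : 'M[K]_(m, p)) :
  frob_ip (W *m A) B = frob_ip A (W^T *m B).
Proof. by rewrite /frob_ip trmx_mul mulmxA. Qed.

Lemma frob_ge0 m n (A : 'M[K]_(m, n)) : 0 <= frob A.
Proof. exact: sqrtr_ge0. Qed.

Lemma frob_sqr m n (A : 'M[K]_(m, n)) : frob A ^+ 2 = frob_ip A A.
Proof.
rewrite sqr_sqrtr ?frob_ipE.
  by apply: eq_bigr => i _; apply: eq_bigr => j _; rewrite expr2.
by apply: sumr_ge0 => i _; apply: sumr_ge0 => j _; exact: sqr_ge0.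
Qed.

Lemma frob_sqrE m n (A : 'M[K]_(m, n)) :
  frob A ^+ 2 = \sum_i \sum_j A i j ^+ 2.
Proof.
by rewrite frob_sqr frob_ipE; do 2!apply: eq_bigr => ? _; rewrite expr2.
Qed.

Lemma frob_eq0 m n (A : 'M[K]_(m, n)) : frob A = 0 -> A = 0.
Proof.
move=> /(congr1 (fun x => x ^+ 2)); rewrite expr0n /= frob_sqrE => /eqP A0.
apply/matrixP => i j; rewrite mxE; apply/eqP; rewrite -sqrf_eq0.
move: A0; rewrite psumr_eq0 => [/allP/(_ i)|k _]; last first.
  by apply: sumr_ge0 => l _; exact: sqr_ge0.
rewrite mem_index_enum => /(_ isT) /=.
rewrite psumr_eq0 => [/allP/(_ j)|l _]; last exact: sqr_ge0.
by rewrite mem_index_enum => /(_ isT).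
Qed.

Lemma le_frob_sqr m n p q (A : 'M[K]_(m, n)) (B : 'M[K]_(p, q)) :
  (frob A <= frob B) = (frob A ^+ 2 <= frob B ^+ 2).
Proof. by rewrite ler_pXn2r // nnegrE frob_ge0. Qed.

(** Cauchy-Schwarz: for nonzero norms, expand the squared norm of [frob B *: A - frob A *: B], which
    is nonnegative. *)
Lemma frob_ip_le m n (A B : 'M[K]_(m, n)) : frob_ip A B <= frob A * frob B.
Proof.
have [/frob_eq0->|B0] := eqVneq (frob B) 0.
  by rewrite frob_ip0r mulr_ge0 // frob_ge0.
have B_gt0 : 0 < frob B by rewrite lt_neqAle eq_sym B0 frob_ge0.
have [/frob_eq0->|A0] := eqVneq (frob A) 0.
  by rewrite frob_ipC frob_ip0r mulr_ge0 // frob_ge0.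
have A_gt0 : 0 < frob A by rewrite lt_neqAle eq_sym A0 frob_ge0.
have := sqr_ge0 (frob (frob B *: A - frob A *: B)).
rewrite frob_sqr !(frob_ipDl, frob_ipDr, frob_ipNl, frob_ipNr).
rewrite !(frob_ipZl, frob_ipZr) -!frob_sqr (frob_ipC B A).
set a := frob A; set b := frob B; set c := frob_ip A B => h.
have : 0 <= 2 * (b * a) * (a * b - c) by lra.
by rewrite pmulr_rge0 ?mulr_gt0// subr_ge0.
Qed.

Lemma frob_ip_sqr_le m n (A B : 'M[K]_(m, n)) :
  frob_ip A B ^+ 2 <= frob A ^+ 2 * frob B ^+ 2.
Proof.
rewrite -exprMn -ler_sqrt ?sqr_ge0// !sqrtr_sqr.
rewrite (ger0_norm (mulr_ge0 _ _)) ?frob_ge0//.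
have frobN : frob (- A) = frob A.
  apply/eqP; rewrite eq_le !le_frob_sqr !frob_sqr.
  by rewrite frob_ipNl frob_ipNr opprK lexx.
rewrite ler_norml frob_ip_le andbT lerNl -frob_ipNl -frobN.
exact: frob_ip_le.
Qed.

(** Each entry of the product pairs a row of [A] with a column of [B]; square, apply Cauchy-Schwarz
    and sum. *)
Lemma frob_mul m n p (A : 'M[K]_(m, n)) (B : 'M[K]_(n, p)) :
  frob (A *m B) <= frob A * frob B.
Proof.
rewrite -(ler_pXn2r (n := 2)) ?nnegrE ?mulr_ge0 ?frob_ge0//.
rewrite exprMn !frob_sqrE (exchange_big _ _ _ _ _ (fun k j => B k j ^+ 2)) /=.
rewrite mulr_suml; apply: ler_sum => i _; rewrite mulr_sumr.
apply: ler_sum => j _.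
have := frob_ip_sqr_le (row i A) (col j B)^T.
rewrite !frob_sqrE frob_ipE !big_ord1 [(A *m B) i j]mxE.
by congr (is_true (_ ^+ 2 <= _ * _)); apply: eq_bigr => k _; rewrite !mxE.
Qed.

(** * The gradient step *)

Lemma frob_gram m n (W : 'M[K]_(m, n)) : frob (W *m W^T) = frob (W^T *m W).
Proof.
have e2 : frob (W *m W^T) ^+ 2 = frob (W^T *m W) ^+ 2.
  by rewrite !frob_sqr /frob_ip !trmx_mul !trmxK -!mulmxA mxtrace_mulC !mulmxA.
by apply/eqP; rewrite eq_le !le_frob_sqr e2 lexx.
Qed.

Lemma frob_trmx_mul_le m n p (W : 'M[K]_(m, n)) (E : 'M[K]_(m, p)) :
  frob (W^T *m E) ^+ 2 <= frob (W^T *m W) * frob E ^+ 2.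
Proof.
rewrite frob_sqr frob_ip_mull trmxK mulmxA -frob_gram.
apply: le_trans (frob_ip_le _ _) _.
by rewrite mulrC expr2 mulrA ler_wpM2r ?frob_ge0// frob_mul.
Qed.

(** The square of the left side is |D|^2 - 2 mu |W D|^2 + mu^2 |W^T W D|^2, and the last term is at
    most mu^2 |W^T W| |W D|^2 <= 2 mu |W D|^2. *)
Lemma frob_grad_step_le m n p (W : 'M[K]_(m, n)) (mu : K) (D : 'M[K]_(n, p)) :
  0 <= mu -> mu * frob (W^T *m W) <= 2 ->
  frob (D - mu *: (W^T *m (W *m D))) <= frob D.
Proof.
move=> mu0 mu2; rewrite le_frob_sqr.
rewrite [leLHS]frob_sqr !(frob_ipDl, frob_ipDr, frob_ipNl, frob_ipNr).
rewrite !(frob_ipZl, frob_ipZr) -2!frob_sqr (frob_ipC _ D).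
rewrite -frob_ip_mull -frob_sqr.
have := ler_wpM2l mu0 (frob_trmx_mul_le W (W *m D)).
have := ler_wpM2r (sqr_ge0 (frob (W *m D))) mu2.
set e := frob (W *m D) ^+ 2; set g := frob (W^T *m _) ^+ 2.
rewrite -mulrA => h1 h2; have := ler_wpM2l mu0 (le_trans h2 h1).
by lra.
Qed.

(** * Projection onto the nonnegative matrices *)

Lemma map_mx_max0_dist_le m n (A B : 'M[K]_(m, n)) :
  frob (map_mx (Num.max 0) A - map_mx (Num.max 0) B) <= frob (A - B).
Proof.
rewrite le_frob_sqr !frob_sqrE; apply: ler_sum => i _; apply: ler_sum => j _.
rewrite !mxE; move: (A i j) (B i j) => a b; have ab := sqr_ge0 (a - b).
by rewrite !maxEle; case: (leP 0 a) => a0; case: (leP 0 b) => b0; nra.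
Qed.

(* Componentwise, [x = max a 0] satisfies the variational inequality
   [(a - x) * (b - x) <= 0] for all [b >= 0]. *)
Lemma metric_proj_nonneg m n (A : 'M[K]_(m, n)) :
  metric_proj (nonneg_mx K m n) A = map_mx (Num.max 0) A.
Proof.
set P := map_mx _ A.
have P0 : nonneg_mx K m n P by move=> i j; rewrite mxE le_max lexx.
(* The extra term |B - P|^2 gives uniqueness of the nearest point along with minimality of [P]. *)
have key B : nonneg_mx K m n B ->
    frob (A - P) ^+ 2 + frob (B - P) ^+ 2 <= frob (A - B) ^+ 2.
  move=> B0; rewrite !frob_sqrE -big_split; apply: ler_sum => i _.
  rewrite -big_split; apply: ler_sum => j _; have := B0 i j.
  rewrite !mxE maxEle; move: (A i j) (B i j) => a b.
  by case: (leP 0 a) => ? ?; rewrite /=; nra.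
apply: xget_unique => [|B [B0 /(_ _ P0)]].
  split=> // B B0; rewrite le_frob_sqr; apply: le_trans (key _ B0).
  by rewrite lerDl sqr_ge0.
rewrite le_frob_sqr => AB; apply/eqP; rewrite -subr_eq0; apply/eqP/frob_eq0/eqP.
rewrite -sqrf_eq0 eq_le sqr_ge0 andbT.
by have := key _ B0; lra.
Qed.

(** * Expansion and gradient of the objective *)

Lemma nmf_obj_expand M N R (V : 'M[K]_(M, N)) (W : 'M[K]_(M, R))
    (H D : 'M[K]_(R, N)) :
  nmf_obj V W (H + D) = nmf_obj V W H + frob_ip (W^T *m (W *m H - V)) D
    + 2^-1 * frob (W *m D) ^+ 2.
Proof.
rewrite /nmf_obj (frob_ipC _ D) -frob_ip_mull mulmxDr opprD addrA.
rewrite !frob_sqr !(frob_ipDl, frob_ipDr, frob_ipNl, frob_ipNr).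
rewrite (frob_ipC (W *m H) V) (frob_ipC (W *m D) V).
by rewrite (frob_ipC (W *m D) (W *m H)); field.
Qed.

(** For t != 0 the difference quotient equals c + t q, which tends to c. *)
Lemma derive_quadratic (U : normedModType K) (g : U -> K) (a v : U) (c q : K) :
  (forall t, g (a + t *: v) = g a + t * c + t ^+ 2 * q) -> 'D_v g a = c.
Proof.
move=> gE; apply: cvg_lim => //.
have : (fun t : K => c + t * q) @ (0 : K)^' --> c.
  rewrite -[X in _ --> X]addr0 -[X in _ --> _ + X](mul0r q).
  apply: cvg_within_filter; apply: cvgD; first exact: cvg_cst.
  by apply: cvgM; [exact: cvg_id | exact: cvg_cst].
apply: cvg_trans; apply: near_eq_cvg; near=> t.
have t0 : t != 0 by near: t; exact: nbhs_dnbhs_neq.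
by rewrite /= [_ *: v + a]addrC gE /GRing.scale /=; field.
Unshelve. all: by end_near. Qed.

Lemma frob_ip_delta m n (A : 'M[K]_(m, n)) i j :
  frob_ip A (delta_mx i j) = A i j.
Proof.
rewrite frob_ipE (bigD1 i)//= (bigD1 j)//= !mxE !eqxx mulr1.
rewrite !big1 ?addr0// => k ki; last by rewrite !mxE (negbTE ki) andbF mulr0.
by apply: big1 => l _; rewrite !mxE (negbTE ki) mulr0.
Qed.

Lemma gradient_nmf_obj M N R (V : 'M[K]_(M, N)) (W : 'M[K]_(M, R))
    (H : 'M[K]_(R, N)) :
  gradient (nmf_obj V W) H = W^T *m (W *m H - V).
Proof.
apply/matrixP => i j; rewrite mxE -[RHS]frob_ip_delta.
apply: (derive_quadratic (q := 2^-1 * frob (W *m delta_mx i j) ^+ 2)) => t.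
rewrite nmf_obj_expand frob_ipZr !frob_sqr -scalemxAr frob_ipZl frob_ipZr.
by congr (_ + _); ring.
Qed.

End FrobeniusGeometry.

Theorem proposition2p1 (K : realType) (M N R : nat)
    (M_gt0 : (0 < M)%N) (N_gt0 : (0 < N)%N) (R_gt0 : (0 < R)%N)
    (R_lt : (R < minn M N)%N)
    (V : 'M[K]_(M, N)) (V_ge0 : nonneg_mx K M N V)
    (W : 'M[K]_(M, R)) (mu : K) (mu_ge0 : 0 <= mu)
    (mu_le : W != 0 -> mu <= 2 / frob (W^T *m W)) :
  [/\ forall H : 'M[K]_(R, N),
        nmf_T V W mu H
        = metric_proj (nonneg_mx K R N) (H - mu *: (W^T *m (W *m H - V))),
      nonexpansive (nmf_T V W mu)
    & 0 < mu ->
        Fix (nmf_T V W mu) = argmin (nonneg_mx K R N) (nmf_obj V W)].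
Proof.
have TE H : nmf_T V W mu H
    = map_mx (Num.max 0) (H - mu *: (W^T *m (W *m H - V))).
  by rewrite /nmf_T gradient_nmf_obj metric_proj_nonneg.
split=> [H|A B|mu_gt0]; first by rewrite TE metric_proj_nonneg.
- rewrite !TE; apply: le_trans (map_mx_max0_dist_le _ _) _.
  have -> : A - mu *: (W^T *m (W *m A - V)) - (B - mu *: (W^T *m (W *m B - V)))
      = A - B - mu *: (W^T *m (W *m (A - B))).
    rewrite !(mulmxBr, scalerBr).
    by apply/matrixP => i j; rewrite !mxE; ring.
  apply: frob_grad_step_le => //.
  (* Splitting on this norm makes the bound trivial at zero; otherwise [W] is nonzero and the
     division is legitimate. *)
  have [F0|F0] := eqVneq (frob (W^T *m W)) 0; first by rewrite F0 mulr0.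
  have W0 : W != 0.
    apply: contraNneq F0 => ->.
    by rewrite -sqrf_eq0 frob_sqr mulmx0 frob_ip0r.
  by rewrite -ler_pdivlMr ?mu_le// lt_neqAle eq_sym F0 frob_ge0.
apply/seteqP; split=> H; rewrite /Fix /=.
- rewrite TE; set G := W^T *m _ => HE.
  (* Entrywise, HE is complementarity: h >= 0, g >= 0, h * g = 0. *)
  have H0 : nonneg_mx K R N H by move=> i j; rewrite -HE mxE le_max lexx.
  split=> // H' H'0; rewrite -(subrKC H H') nmf_obj_expand -/G -addrA lerDl.
  apply: addr_ge0; last by rewrite mulr_ge0 ?sqr_ge0// invr_ge0.
  clearbody G; rewrite frob_ipE.
  apply: sumr_ge0 => i _; apply: sumr_ge0 => j _.
  rewrite -(pmulr_rge0 _ mu_gt0).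
  have := H'0 i j; have := H0 i j; move/matrixP/(_ i j): HE; rewrite !mxE.
  move: (H i j) (H' i j) (G i j) => h h' g.
  by rewrite maxEle; case: (leP 0 (h - mu * g)); nra.
move=> [H0 Hmin]; rewrite TE; set G := W^T *m _.
set P := map_mx _ _; pose D := P - H.
have P0 : nonneg_mx K R N P by move=> i j; rewrite mxE le_max lexx.
(* Obtuse-angle property of the projection, tested at [H]: entrywise, with p = max(0, h - mu g), the
   summand is (p - h)(p - (h - mu g)) <= 0. *)
have GD : mu * frob_ip G D + frob D ^+ 2 <= 0.
  clearbody G; rewrite frob_ipE frob_sqrE mulr_sumr -big_split /=.
  apply: sumr_le0 => i _; rewrite mulr_sumr -big_split /=.
  apply: sumr_le0 => j _; have := H0 i j; rewrite !mxE.
  move: (H i j) (G i j) => h g.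
  by rewrite maxEle; case: (leP 0 (h - mu * g)); nra.
(* [H + t *: D] is a convex combination of [H] and [P], hence feasible; compare its value with the
   minimum and divide by t. *)
have tD t : 0 < t <= 1 -> 0 <= frob_ip G D + t * (2^-1 * frob (W *m D) ^+ 2).
  move=> /andP[t0 t1].
  have : nonneg_mx K R N (H + t *: D).
    move=> i j; have -> : (H + t *: D) i j = (1 - t) * H i j + t * P i j.
      by rewrite !mxE; ring.
    by rewrite addr_ge0 ?mulr_ge0 ?subr_ge0 ?(ltW t0).
  move=> /Hmin; rewrite nmf_obj_expand -/G -addrA lerDl -scalemxAr.
  rewrite [frob (_ *: _) ^+ 2]frob_sqr frob_ipZl !frob_ipZr -frob_sqr.
  by move=> ?; rewrite -(pmulr_rge0 _ t0); lra.
have ipD : 0 <= frob_ip G D.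
  rewrite leNgt; apply/negP => c0.
  set q := 2^-1 * _ in tD; have q0 : 0 <= q by rewrite mulr_ge0 ?sqr_ge0.
  set c := frob_ip G D in tD c0.
  have q1 : 0 < q - c by lra.
  (* If c < 0, this t makes c + t q = c / 2 + t c < 0, against [tD]; subtracting c in the
     denominator keeps it positive when q = 0 and keeps t <= 1. *)
  set t := (- c / 2) / (q - c).
  have tE : t * (q - c) = - c / 2 by rewrite divfK ?gt_eqF.
  have t0 : 0 < t by rewrite divr_gt0//; lra.
  have t1 : t <= 1 by rewrite ler_pdivrMr//; lra.
  by have := tD t; rewrite t0 t1 => /(_ isT); nra.
apply/eqP; rewrite -subr_eq0; apply/eqP/frob_eq0/eqP; rewrite -/D -sqrf_eq0.
rewrite eq_le sqr_ge0 andbT.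
by have := mulr_ge0 mu_ge0 ipD; lra.
Qed.
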